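(* Let $X,Y$ be pointed metric spaces. If $0<p\le s$, then $$\Pi^L_{(p,\mathfrak{m}^L(s;p))}(X,Y)\subset\Pi^L_{(s,\mathfrak{m}^L(s;s))}(X,Y).$$ Moreover $\pi^L_{(s,\mathfrak{m}^L(s;s))}(T)\le\pi^L_{(p,\mathfrak{m}^L(s;p))}(T)$ for every $T\in\Pi^L_{(p,\mathfrak{m}^L(s;p))}(X,Y)$.
   Context: For a metric space $X$ with base point $x_0$, $X^{\#}$ is the Banach space of real-valued Lipschitz functions on $X$ vanishing at $x_0$, with norm $Lip(\cdot)$ (the Lipschitz constant); $B_{X^{\#}}$ is its closed unit ball. $(\sigma,x',x'')$ denotes a finite sequence $(\sigma_j,x'_j,x''_j)_{j=1}^m$ in $\mathbb{R}\times X\times X$. Indices lie in $(0,\infty]$, $1/\infty=0$. Put $\|(\sigma,x',x'')|\ell_p\|=\big[\sum_j|\sigma_j|^p d_X(x'_j,x''_j)^p\big]^{1/p}$ and $\|(\sigma,x',x'')|\ell_p^{L,w}\|=\sup_{f\in B_{X^{\#}}}\big[\sum_j|\sigma_j|^p|f(x'_j)-f(x''_j)|^p\big]^{1/p}$ (sums replaced by suprema over $j$ if $p=\infty$). For $0<q\le s\le\infty$ let $s'(q)\in(0,\infty]$ be given by $\frac1{s'(q)}+\frac1s=\frac1q$, and put $\mathfrak{m}^L_{(s;q)}(\sigma,x',x'')=\inf_\tau\|\tau|\ell_{s'(q)}\|\,\|(\sigma/\tau,x',x'')|\ell_s^{L,w}\|$, the infimum over all $\tau=(\tau_j)$ with $\tau_j\in\mathbb{R}\setminus\{0\}$,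 where $\sigma/\tau=(\sigma_j/\tau_j)_j$. In particular $\mathfrak{m}^L_{(s;s)}(\sigma,x',x'')=\|(\sigma,x',x'')|\ell_s^{L,w}\|$. For $q\le s$ and $p\ge q$, a Lipschitz map $T:X\to Y$ is Lipschitz $(p,\mathfrak{m}^L(s;q))$-summing if there is $C\ge0$ with $\|(\sigma,Tx',Tx'')|\ell_p\|\le C\,\mathfrak{m}^L_{(s;q)}(\sigma,x',x'')$ for all finite sequences $(\sigma,x',x'')$ in $\mathbb{R}\times X\times X$; $\Pi^L_{(p,\mathfrak{m}^L(s;q))}(X,Y)$ is the class of all such maps and $\pi^L_{(p,\mathfrak{m}^L(s;q))}(T)$ is the infimum of such $C$. *)

(* Defs.v *)
From mathcomp Require Import all_boot all_order all_algebra.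
From mathcomp Require Import all_classical all_reals all_analysis.

Set Implicit Arguments.
Unset Strict Implicit.
Unset Printing Implicit Defensive.

Import Order.TTheory GRing.Theory Num.Theory.
Import numFieldNormedType.Exports.

Local Open Scope classical_set_scope.
Local Open Scope ring_scope.

Definition lipschitz_with (R : realType) (X Y : metricType R) (L : R)
    (f : X -> Y) : Prop :=
  forall x y : X, mdist (f x) (f y) <= L * mdist x y.

Definition is_lipschitz (R : realType) (X Y : metricType R)
    (f : X -> Y) : Prop :=
  exists L : R, lipschitz_with L f.

(* The least Lipschitz constant, +oo when f is not Lipschitz. *)
Definition lip_const (R : realType) (X Y : metricType R) (f : X -> Y) : \bar R :=
  ereal_inf [set L%:E | L in [set L : R | 0 <= L /\ lipschitz_with L f]].

(* R carries its metric structure under the alias R^o. *)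
Definition lip_dual (R : realType) (X : metricType R) (x0 : X) :
    set (X -> R^o) :=
  [set f : X -> R^o | is_lipschitz f /\ f x0 = 0].

Definition lip_dual_ball (R : realType) (X : metricType R) (x0 : X) :
    set (X -> R^o) :=
  [set f : X -> R^o | lip_dual x0 f /\ (lip_const f <= 1)%E].

(* For indices p in ]0, +oo]; the value at the junk index -oo is irrelevant.
   The suprema for p = +oo are taken among nonnegative numbers, so that the
   empty sequence has norm 0. *)
Definition lp_norm (R : realType) (p : \bar R) (m : nat) (a : 'I_m -> R) : R :=
  match p with
  | r%:E => (\sum_(j < m) `|a j| `^ r) `^ r^-1
  | _ => \big[Num.max/0]_(j < m) `|a j|
  end.

Definition lp_seq_norm (R : realType) (X : metricType R) (p : \bar R) (m : nat)
    (sigma : 'I_m -> R) (x' x'' : 'I_m -> X) : R :=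
  lp_norm p (fun j => `|sigma j| * mdist (x' j) (x'' j)).

Definition weak_lp_seq_norm (R : realType) (X : metricType R) (x0 : X)
    (p : \bar R) (m : nat) (sigma : 'I_m -> R) (x' x'' : 'I_m -> X) : \bar R :=
  ereal_sup
    [set (lp_norm p (fun j => `|sigma j| * `|f (x' j) - f (x'' j)|))%:E
      | f in lip_dual_ball x0].

(* s'(q); extended inverses satisfy +oo^-1 = 0 and 0^-1 = +oo. *)
Definition mixed_index (R : realType) (s q : \bar R) : \bar R :=
  ((q^-1 - s^-1)^-1)%E.

Lemma mixed_indexE (R : realType) (s q : \bar R) : (0 < q)%E -> (q <= s)%E ->
  ((mixed_index s q)^-1 + s^-1 = q^-1)%E.
Proof.
move=> q0 qs; rewrite /mixed_index inveK.
have s0 : (0 < s)%E := lt_le_trans q0 qs.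
rewrite subeK//; move: s0; case: s {qs} => [r| |]// r0.
by rewrite inver gt_eqF.
Qed.

Lemma mixed_index_gt0 (R : realType) (s q : \bar R) : (0 < q)%E -> (q <= s)%E ->
  (0 < mixed_index s q)%E.
Proof.
rewrite /mixed_index; case: q => [q| |]// q0; case: s => [s| |]// qs; last 2 first.
- by rewrite invey sube0 inveK.
- by rewrite invey subee// inve0.
have s0 : 0 < s by rewrite -lte_fin; exact: lt_le_trans qs.
rewrite !inver !gt_eqF// -EFinB inver; case: eqVneq => // d0.
rewrite lte_fin invr_gt0 lt_def d0 subr_ge0 lef_pV2//.
Qed.

(* The norm of mixed sums, with sigma / tau taken pointwise. *)
Definition mixed_norm (R : realType) (X : metricType R) (x0 : X)
    (s q : \bar R) (m : nat) (sigma : 'I_m -> R) (x' x'' : 'I_m -> X) : \bar R :=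
  ereal_inf
    [set ((lp_norm (mixed_index s q) tau)%:E *
          weak_lp_seq_norm x0 s (fun j => (sigma j / tau j)%R) x' x'')%E
      | tau in [set tau : 'I_m -> R | forall j, tau j != 0]].

Definition mixed_summing_bound (R : realType) (X Y : metricType R) (x0 : X)
    (p s q : \bar R) (T : X -> Y) (C : R) : Prop :=
  forall (m : nat) (sigma : 'I_m -> R) (x' x'' : 'I_m -> X),
    ((lp_seq_norm p sigma (T \o x') (T \o x''))%:E
       <= C%:E * mixed_norm x0 s q sigma x' x'')%E.

(* The class of Lipschitz (p, m^L(s;q))-summing maps, for q <= s and q <= p. *)
Definition mixed_summing (R : realType) (X Y : metricType R) (x0 : X)
    (p s q : \bar R) : set (X -> Y) :=
  [set T | is_lipschitz T /\
           exists C : R, 0 <= C /\ mixed_summing_bound x0 p s q T C].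

Definition mixed_summing_const (R : realType) (X Y : metricType R) (x0 : X)
    (p s q : \bar R) (T : X -> Y) : \bar R :=
  ereal_inf
    [set C%:E | C in [set C : R | 0 <= C /\ mixed_summing_bound x0 p s q T C]].

Arguments mixed_summing {R} X Y x0 p s q.

(* Main.v *)
Require Import Defs.
From mathcomp Require Import all_boot all_order all_algebra.
From mathcomp Require Import all_classical all_reals all_analysis.

Import Order.TTheory GRing.Theory Num.Theory.

Local Open Scope classical_set_scope.
Local Open Scope ring_scope.

(** The theorem compares two Lipschitz summing conditions on [T] by a duality
    argument. With [1/r + 1/s = 1/p], Hölder's inequality is sharp: the [l_s]
    norm of a finite sequence [a >= 0] equals the [l_p] norm of [tau * a] for a
    suitable multiplier [tau] in the unit ball of [l_r]. Apply this to
    [a j = |sigma j| d(T x'_j, T x''_j)], and use the [(p, m(s;p))]-bound for the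
    sequence [(tau sigma, x', x'')]. In the infimum defining the mixed norm of
    that sequence, [tau] itself is an admissible divisor; it gives back [sigma],
    so the mixed norm is at most [|tau|_r] times the weak [l_s] norm of
    [(sigma, x', x'')], and [|tau|_r <= 1]. Hence the strong [l_s] norm of the
    image is at most [C] times the weak [l_s] norm, with the same [C], which
    gives both the inclusion and the comparison of the constants.

    Divisors in the mixed norm must not vanish, whereas for [p < s] the optimal
    multiplier vanishes wherever [a] does (and, for [s = +oo], may have to vanish
    everywhere but at one maximal entry). The multiplier is therefore sought on a subsequence, given
    by an injection [h] of index sets ([lp_norm_le_multiplier]); passing to a
    subsequence only decreases the weak norm ([weak_lp_seq_norm_inj]). At the
    other end, the mixed norm for [(s;s)] dominates the weak [l_s] norm
    ([weak_lp_seq_norm_le_mixed]). *)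

(** Serves both as monotonicity ([h = id]) and for passing to subsequences. *)
Lemma lp_norm_le_inj {R : realType} {p : \bar R} {k m : nat} {h : 'I_k -> 'I_m}
    {a : 'I_k -> R} {b : 'I_m -> R} :
  (0 < p)%E -> injective h -> (forall i, `|a i| <= `|b (h i)|) ->
  lp_norm p a <= lp_norm p b.
Proof.
case: p => [r| |]// r0 hinj ab /=; last first.
  apply: bigmax_le => [|i _]; first exact: bigmax_ge_id.
  by rewrite (le_trans (ab i))// le_bigmax.
rewrite lte_fin in r0; apply: ge0_ler_powR.
- by rewrite invr_ge0 ltW.
- by rewrite nnegrE sumr_ge0.
- by rewrite nnegrE sumr_ge0.
apply: (@le_trans _ _ (\sum_(i < k) `|b (h i)| `^ r)).
  by apply: ler_sum => i _; rewrite ge0_ler_powR ?nnegrE// ltW.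
rewrite -(big_imset (fun j => `|b j| `^ r) (in2W hinj)) /=.
rewrite [leRHS](bigID (mem (h @: xpredT)))/= lerDl.
by rewrite sumr_ge0.
Qed.

Lemma lp_normZ {R : realType} {p : \bar R} {m : nat} (c : R) (a : 'I_m -> R) :
  (0 < p)%E -> 0 <= c -> lp_norm p (fun j => c * a j) = c * lp_norm p a.
Proof.
case: p => [r| |]// r0 c0 /=; last first.
  rewrite (big_morph (fun x => c * x) (fun x y => maxr_pMr x y c0) (mulr0 c)).
  by apply: eq_bigr => j _; rewrite normrM (ger0_norm c0).
rewrite lte_fin in r0.
under eq_bigr do rewrite normrM (ger0_norm c0) powRM//.
rewrite -mulr_sumr powRM ?powR_ge0 ?sumr_ge0//.
by rewrite -powRrM divff ?gt_eqF// powRr1.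
Qed.

(** The index is the inverse of the extended real [0], which is [+oo]: for
    equal indices the multipliers are measured in the supremum norm. *)
Lemma mixed_indexxx {R : realType} {p : \bar R} :
  (0 < p)%E -> mixed_index p p = +oo%E.
Proof.
rewrite /mixed_index; case: p => [r| |]//.
  by rewrite lte_fin => r0; rewrite inver gt_eqF// subee// inve0.
by rewrite invey sube0 inve0.
Qed.

(** Equality case of Hölder's inequality for finite exponents. After division by
    [N = |a|_s], the sequence [b = a / N] has [l_s] norm [1], and the multiplier
    [b ^ (s/r)] with [1/r = 1/p - 1/s] has [l_r] norm [1]. Since
    [s/r + 1 = s/p], the product with [a] is [N * b ^ (s/p)], of [l_p] norm [N].
    The subsequence consists of the nonzero entries of [a]. *)
Lemma lp_norm_le_multiplier_fin {R : realType} {p s : R} {m : nat}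
    (a : 'I_m -> R) : 0 < p -> p < s -> (forall j, 0 <= a j) ->
  exists k (h : 'I_k -> 'I_m) (tau : 'I_k -> R),
    [/\ injective h, forall i, 0 < tau i,
        lp_norm (p^-1 - s^-1)^-1%:E tau <= 1
      & lp_norm s%:E a <= lp_norm p%:E (fun i => tau i * a (h i))].
Proof.
move=> p0 ps a0; have s0 := lt_trans p0 ps.
have d0 : 0 < p^-1 - s^-1 by rewrite subr_gt0 ltf_pV2.
pose A := [set j | 0 < a j]%SET; pose h (i : 'I_#|A|) := enum_val i.
have ah i : 0 < a (h i) by move: (enum_valP i); rewrite inE.
have sumA e : e != 0 -> \sum_(i < #|A|) a (h i) `^ e = \sum_j `|a j| `^ e.
  move=> e0; rewrite [RHS](bigID (mem A))/= [X in _ + X]big1 ?addr0 => [|j].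
    rewrite [RHS]big_enum_val/=; apply: eq_bigr => i _.
    by rewrite ger0_norm.
  rewrite inE lt_def a0 andbT negbK => /eqP ->.
  by rewrite normr0 powR0.
set N := lp_norm s%:E a.
have N0 : 0 <= N by exact: powR_ge0.
have NsE : N `^ s = \sum_(i < #|A|) a (h i) `^ s.
  rewrite sumA ?gt_eqF// -powRrM mulVf ?gt_eqF// powRr1// sumr_ge0//.
(* If [a = 0], the empty subsequence will do. *)
have [Ngt0|] := ltP 0 N; last first.
  move=> N_le0; exists 0, (widen_ord (leq0n m)), (fun=> 1).
  split => //; rewrite ?(le_trans N_le0) ?powR_ge0//=.
  - by case.
  - by rewrite big_ord0 powR0// invr_eq0 gt_eqF// invr_gt0.
pose b i := a (h i) / N.
have b0 i : 0 < b i by rewrite divr_gt0.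
have sumb : \sum_(i < #|A|) b i `^ s = 1.
  under eq_bigr do rewrite powRM ?invr_ge0//.
  by rewrite -mulr_suml -NsE -powRM ?invr_ge0// divff ?gt_eqF// powR1.
exists #|A|, h, (fun i => b i `^ (s * (p^-1 - s^-1))); split=> [|i||].
- exact: enum_val_inj.
- exact: powR_gt0.
- rewrite /=.
  under eq_bigr do rewrite ger0_norm ?powR_ge0// -powRrM mulfK ?gt_eqF//.
  by rewrite sumb powR1.
- have tau_a i : b i `^ (s * (p^-1 - s^-1)) * a (h i) = N * b i `^ (s / p).
    rewrite -[s / p](subrK 1) powRD ?(gt_eqF (b0 i)) ?implybT//.
    rewrite powRr1 ?ltW// mulrCA [N * _]mulrC divfK ?gt_eqF//.
    by rewrite mulrBr divff ?gt_eqF.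
  rewrite (funext tau_a) lp_normZ ?lte_fin//=.
  under eq_bigr do rewrite ger0_norm ?powR_ge0// -powRrM divfK ?gt_eqF//.
  by rewrite sumb powR1 mulr1.
Qed.

(** The extreme cases of the equality case of Hölder's inequality are easier:
    for [p = s] the constant multiplier [1] has supremum norm at most [1], and
    for [s = +oo] the one-term subsequence of a maximal entry carries the whole
    supremum norm of [a]. *)
Lemma lp_norm_le_multiplier {R : realType} {p s : \bar R} {m : nat}
    (a : 'I_m -> R) : (0 < p)%E -> (p <= s)%E -> (forall j, 0 <= a j) ->
  exists k (h : 'I_k -> 'I_m) (tau : 'I_k -> R),
    [/\ injective h, forall i, 0 < tau i,
        lp_norm (mixed_index s p) tau <= 1
      & lp_norm s a <= lp_norm p (fun i => tau i * a (h i))].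
Proof.
move=> p0; rewrite le_eqVlt => /predU1P[<-{s}|ps] a0.
  exists m, id, (fun=> 1); split => //; last first.
    by rewrite (_ : (fun i => 1 * a i) = a)//; apply/funext => i; rewrite mul1r.
  rewrite mixed_indexxx//.
  by apply: bigmax_le => // i _; rewrite normr1.
case: p p0 ps => [p| |]//; case: s => [s| |]//; rewrite !lte_fin => p0 ps.
  have s0 : 0 < s := lt_trans p0 ps.
  rewrite /mixed_index !inver !gt_eqF//.
  rewrite -EFinB inver gt_eqF ?subr_gt0 ?ltf_pV2 ?posrE//.
  exact: lp_norm_le_multiplier_fin.
(* Here [s = +oo > p]; a maximal entry exists unless the sequence is empty. *)
case: m a a0 => [|m] a a0.
  exists 0, id, (fun=> 1); split => //.
    rewrite /mixed_index invey sube0 inveK/= big_ord0 powR0//.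
    by rewrite invr_eq0 gt_eqF.
  by rewrite /= big_ord0 powR_ge0.
pose j0 := [arg max_(j > ord0) a j]%O.
exists 1, (fun=> j0), (fun=> 1); split => //.
- by move=> i j _; rewrite !ord1.
- by rewrite /mixed_index invey sube0 inveK/= big_ord1 normr1 !powR1.
rewrite /= big_ord1 mul1r -powRrM divff ?gt_eqF// powRr1//.
apply: bigmax_le => // j _; rewrite !ger0_norm// /j0.
by case: arg_maxP => // i _; apply.
Qed.

Lemma weak_lp_seq_norm_inj {R : realType} {X : metricType R} (x0 : X)
    {s : \bar R} {k m : nat} {h : 'I_k -> 'I_m} (sigma : 'I_m -> R)
    (x' x'' : 'I_m -> X) : (0 < s)%E -> injective h ->
  (weak_lp_seq_norm x0 s (sigma \o h) (x' \o h) (x'' \o h)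
     <= weak_lp_seq_norm x0 s sigma x' x'')%E.
Proof.
move=> s0 hinj; apply: ge_ereal_sup => _ [f fB <-].
apply: (@le_trans _ _ (lp_norm s
    (fun j => `|sigma j| * `|f (x' j) - f (x'' j)|))%:E).
  by rewrite lee_fin; exact: lp_norm_le_inj s0 hinj _.
by apply: ereal_sup_ubound; exists f.
Qed.

(** For every divisor [tau], [|sigma| <= |tau|_oo |sigma / tau|] entrywise, so the
    divisors cannot bring the [(s;s)] mixed norm below its value at [tau = 1]. *)
Lemma weak_lp_seq_norm_le_mixed {R : realType} {X : metricType R} (x0 : X)
    {s : \bar R} {m : nat} (sigma : 'I_m -> R) (x' x'' : 'I_m -> X) :
  (0 < s)%E ->
  (weak_lp_seq_norm x0 s sigma x' x'' <= mixed_norm x0 s s sigma x' x'')%E.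
Proof.
move=> s0; apply: le_ereal_inf_tmp => _ [tau /= tau0 <-].
rewrite mixed_indexxx//; apply: ge_ereal_sup => _ [f fB <-].
set M := lp_norm +oo%E tau.
have M0 : 0 <= M by exact: bigmax_ge_id.
apply: (@le_trans _ _ (M * lp_norm s
    (fun j => `|sigma j / tau j| * `|f (x' j) - f (x'' j)|))%:E).
  rewrite lee_fin -lp_normZ//; apply: (@lp_norm_le_inj _ _ _ _ id) => // j.
  rewrite !normrM !normr_id mulrA ler_wpM2r// normfV (ger0_norm M0).
  by rewrite mulrCA ler_peMr// ler_pdivlMr ?normr_gt0// mul1r le_bigmax.
rewrite EFinM lee_wpmul2l ?lee_fin//.
by apply: ereal_sup_ubound; exists f.
Qed.

(** The weak norm is a supremum over a set of functions that contains [0]. *)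
Lemma weak_lp_seq_norm_ge0 {R : realType} {X : metricType R} (x0 : X)
    (s : \bar R) {m : nat} (sigma : 'I_m -> R) (x' x'' : 'I_m -> X) :
  (0 <= weak_lp_seq_norm x0 s sigma x' x'')%E.
Proof.
have lip0 : lipschitz_with 0 (cst 0 : X -> R^o).
  by move=> x y; rewrite mdistxx mul0r.
apply: (@le_trans _ _ (lp_norm s
    (fun j => `|sigma j| * `|(0 : R) - (0 : R)|))%:E).
  rewrite lee_fin; case: s => [r| |] /=; first exact: powR_ge0.
    exact: bigmax_ge_id.
  exact: bigmax_ge_id.
apply: ereal_sup_ubound; exists (cst 0) => //; split.
  by split=> //; exists 0.
by apply: (@le_trans _ _ 0%:E); [apply: ereal_inf_lbound; exists 0|].
Qed.

(** The duality argument; the constant is not changed, which is why it yields the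
    comparison of the summing constants as well. *)
Lemma mixed_summing_bound_transfer {R : realType} {X Y : metricType R} (x0 : X)
    {p s : \bar R} {T : X -> Y} {C : R} : (0 < p)%E -> (p <= s)%E -> 0 <= C ->
  mixed_summing_bound x0 p s p T C -> mixed_summing_bound x0 s s s T C.
Proof.
move=> p0 ps C0 TC m sigma x' x''; have s0 := lt_le_trans p0 ps.
have [|k [h [tau [hinj tau0 tau1 le_a]]]] := lp_norm_le_multiplier
  (fun j => `|sigma j| * mdist (T (x' j)) (T (x'' j))) p0 ps.
  by move=> j; rewrite mulr_ge0// mdist_ge0.
apply: (@le_trans _ _ (lp_seq_norm p (fun i => tau i * sigma (h i))
    (T \o (x' \o h)) (T \o (x'' \o h)))%:E).
  rewrite lee_fin (le_trans le_a)//; apply: (@lp_norm_le_inj _ _ _ _ id) => // i.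
  by rewrite !normrM !normr_id mulrA.
apply: le_trans (TC _ _ _ _) _; apply: lee_wpmul2l; first by rewrite lee_fin.
apply: le_trans (weak_lp_seq_norm_le_mixed x0 sigma x' x'' s0).
apply: le_trans (weak_lp_seq_norm_inj x0 sigma x' x'' s0 hinj).
apply: (@le_trans _ _ ((lp_norm (mixed_index s p) tau)%:E *
    weak_lp_seq_norm x0 s (sigma \o h) (x' \o h) (x'' \o h))%E).
  (* Dividing [tau * sigma] by [tau] itself recovers [sigma]. *)
  apply: ereal_inf_lbound; exists tau => [i|]; first by rewrite gt_eqF.
  congr (_ * weak_lp_seq_norm _ _ _ _ _)%E; apply/funext => i.
  by rewrite mulrC mulKf ?gt_eqF.
rewrite -[leRHS]mul1e; apply: lee_wpmul2r; first exact: weak_lp_seq_norm_ge0.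
by rewrite lee_fin.
Qed.

Theorem theorem4p9 (R : realType) (X Y : metricType R) (x0 : X) (y0 : Y)
    (p s : \bar R) (hp : (0 < p)%E) (hps : (p <= s)%E) :
  mixed_summing X Y x0 p s p `<=` mixed_summing X Y x0 s s s /\
  (forall T : X -> Y, mixed_summing X Y x0 p s p T ->
     (mixed_summing_const x0 s s s T <= mixed_summing_const x0 p s p T)%E).
Proof.
split=> [T [Tlip [C [C0 TC]]]|T _].
  by split=> //; exists C; split=> //; exact: mixed_summing_bound_transfer TC.
apply: le_ereal_inf => _ [C [C0 TC] <-].
by exists C => //; split=> //; exact: mixed_summing_bound_transfer TC.
Qed.
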